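(* The function $F:\mathcal H\times\mathbb C^{nN\times n}\to[0,\infty]$ is convex and lower semicontinuous and equals the (lower semicontinuous) convex envelope of $F_0$, i.e. the largest convex lower semicontinuous function that is $\le F_0$. In addition, the Legendre transform of $F$ is, for $(a,b)\in\mathcal H\times\mathbb C^{nN\times n}$, $$F^*(a,b)=\begin{cases}0&\text{if } a+\frac{b^*b}{2}\le0,\\ \infty&\text{otherwise.}\end{cases}$$
   Context: Fix integers $n,N\ge1$. $\mathcal H$ is the real vector space of $n\times n$ complex Hermitian matrices; $\mathcal H_+$ and $\mathcal H_{++}$ are the positive semidefinite, respectively positive definite, matrices in $\mathcal H$. $\langle X;Y\rangle=\mathrm{tr}(X^*Y)$, and for $m,b\in\mathbb C^{nN\times n}$, $m\cdot b=\frac12(\langle m;b\rangle+\langle b;m\rangle)\in\mathbb R$. $A\le0$ for $A\in\mathcal H$ means that $-A\in\mathcal H_+$. $F_0(\rho,m)=\frac12\langle m;m\rho^{-1}\rangle$ if $\rho\in\mathcal H_{++}$ and $F_0(\rho,m)=\infty$ otherwise. $F$ is defined by: $F(\rho,m)=\frac12\langle m;m\rho^{-1}\rangle$ if $\rho\in\mathcal H_{++}$; $F(\rho,m)=\infty$ if $\rho\in\mathcal H\setminus\mathcal H_+$; and if $\rho\in\mathcal H_+\setminus\mathcal H_{++}$, $F(\rho,m)$ is the infimum of $\liminf_{\ell\to\infty}\frac12\langle m_\ell;m_\ell\rho_\ell^{-1}\rangle$ over all sequences $(\rho_\ell,m_\ell)\in\mathcal H_{++}\times\mathbb C^{nN\times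 n}$ converging to $(\rho,m)$. The Legendre transform is $F^*(a,b)=\sup\{\langle a;\rho\rangle+b\cdot m-F(\rho,m):(\rho,m)\in\mathcal H\times\mathbb C^{nN\times n}\}$. *)

(* Defs.v *)
From HB Require Import structures.
From mathcomp Require Import all_boot all_order all_algebra complex.
From mathcomp Require Import all_classical all_reals all_analysis.
Import numFieldNormedType.Exports.

Set Implicit Arguments.
Unset Strict Implicit.
Unset Printing Implicit Defensive.

Import Order.TTheory GRing.Theory Num.Theory.

Local Open Scope classical_set_scope.
Local Open Scope ring_scope.
Local Open Scope complex_scope.
Local Open Scope sesquilinear_scope.

(* The modulus topology on R[i]; 'M[R[i]]_(p, q) inherits the entrywise one. *)
#[warnings="-redundant-canonical-projection"]
HB.instance Definition _ (R : realType) := NormedModule.copy R[i] R[i]^o.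

(* MathComp makes 'M[R[i]]_(p, q) a module over R[i] only, hence this alias,
   which is a topological space and a module over R. *)
Definition cmx (R : realType) (p q : nat) : Type := 'M[R[i]]_(p, q).

Section RealModule.
Variables (R : realType) (p q : nat).

HB.instance Definition _ := GRing.Zmodule.copy (cmx R p q) 'M[R[i]]_(p, q).
#[warnings="-redundant-canonical-projection"]
HB.instance Definition _ := Topological.copy (cmx R p q) 'M[R[i]]_(p, q).

Definition cmx_scale (t : R) (A : cmx R p q) : cmx R p q :=
  (t%:C *: (A : 'M[R[i]]_(p, q)) : 'M[R[i]]_(p, q)).

Fact cmx_scaleA t s A : cmx_scale t (cmx_scale s A) = cmx_scale (t * s) A.
Proof. by rewrite /cmx_scale scalerA rmorphM. Qed.
Fact cmx_scale1 : left_id 1 cmx_scale.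
Proof. by move=> A; rewrite /cmx_scale rmorph1 scale1r. Qed.
Fact cmx_scaleDr : right_distributive cmx_scale +%R.
Proof. by move=> t A B; rewrite /cmx_scale; exact: scalerDr. Qed.
Fact cmx_scaleDl A : {morph cmx_scale^~ A : t s / t + s}.
Proof. by move=> t s; rewrite /cmx_scale rmorphD; exact: scalerDl. Qed.

HB.instance Definition _ := GRing.Zmodule_isLmodule.Build R (cmx R p q)
  cmx_scaleA cmx_scale1 cmx_scaleDr cmx_scaleDl.
End RealModule.

Section Hermitian.
Variables (R : realType) (n : nat).

Definition hermpred : {pred cmx R n n} :=
  fun A => (A : 'M[R[i]]_n) \is hermsymmx.

Lemma hermpredP (A : cmx R n n) :
  reflect ((A : 'M[R[i]]_n) = A ^t*) (A \in hermpred).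
Proof.
rewrite unfold_in /hermpred is_hermitianmxE expr0 scale1r; exact: eqP.
Qed.

Fact hermpred_submod : submod_closed hermpred.
Proof.
split=> [|t A B /hermpredP hA /hermpredP hB]; apply/hermpredP/matrixP => i j.
  by rewrite !mxE conjC0.
have /matrixP/(_ i j) := hA; have /matrixP/(_ i j) := hB; rewrite !mxE => eB eA.
rewrite eA eB rmorphD rmorphM /=; congr (_ * _ + _).
by apply/eqP; rewrite eq_complex /= oppr0 !eqxx.
Qed.

HB.instance Definition _ := GRing.isSubmodClosed.Build R (cmx R n n) hermpred
  hermpred_submod.

Record herm := Herm { hermval : cmx R n n; _ : hermpred hermval }.
Coercion hermmx (A : herm) : 'M[R[i]]_n := hermval A.

HB.instance Definition _ := [isSub for hermval].
HB.instance Definition _ := [Choice of herm by <:].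
HB.instance Definition _ := [SubChoice_isSubLmodule of herm by <:].
HB.instance Definition _ :=
  Topological.copy herm (initial_topology hermval).
End Hermitian.

(* H x C^(nN x n), with the product topology and real vector space structure. *)
Notation phase R n N := (herm R n * cmx R (n * N) n)%type.

Section Matrices.
Variable R : realType.
Implicit Types p q n N : nat.

(* In R[i], 0 <= z and 0 < z entail that z is real. *)
Definition psdmx n (A : 'M[R[i]]_n) : Prop :=
  A \is hermsymmx /\ forall v : 'cV[R[i]]_n, 0 <= (v ^t* *m A *m v) 0 0.

Definition pdmx n (A : 'M[R[i]]_n) : Prop :=
  A \is hermsymmx /\
  forall v : 'cV[R[i]]_n, v != 0 -> 0 < (v ^t* *m A *m v) 0 0.

Definition npsdmx n (A : 'M[R[i]]_n) : Prop := psdmx (- A).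

Definition mxdot p q (X Y : 'M[R[i]]_(p, q)) : R[i] := \tr (X ^t* *m Y).

(* Each of the next three scalars is real as an element of R[i], so that
   taking the real part only changes its type: see [hdot_real],
   [rdot_real] and [kinetic_real]. *)
Definition hdot n (a rho : herm R n) : R := complex.Re (mxdot a rho).

Definition rdot p q (m b : cmx R p q) : R :=
  complex.Re (2^-1 * (mxdot m b + mxdot b m)).

Definition kinetic n N (x : phase R n N) : R :=
  complex.Re (2^-1 * mxdot x.2 ((x.2 : 'M[R[i]]_(n * N, n)) *m invmx x.1)).

Lemma mxdotC p q (X Y : 'M[R[i]]_(p, q)) : ((mxdot X Y)^*)%R = mxdot Y X.
Proof.
rewrite /mxdot -[in RHS](trmxCK X) -mxtrace_tr -trace_map_mx; congr (\tr _).
by rewrite trmx_mul map_mxM trmxCK.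
Qed.

Lemma real_Re (z : R[i]) : (z^*)%R = z -> (complex.Re z)%:C = z.
Proof.
by case: z => x y /eqP; rewrite eq_complex /= eqxx eqNr => /eqP->.
Qed.

Lemma herm_adj n (a : herm R n) : (a : 'M[R[i]]_n) ^t* = a.
Proof. by case: a => a /= /hermpredP. Qed.

Lemma hdot_real n (a rho : herm R n) : (hdot a rho)%:C = mxdot a rho.
Proof. by apply: real_Re; rewrite mxdotC /mxdot !herm_adj mxtrace_mulC. Qed.

Lemma rdot_real p q (m b : cmx R p q) :
  (rdot m b)%:C = 2^-1 * (mxdot m b + mxdot b m).
Proof.
apply: real_Re; rewrite rmorphM /= rmorphD /= !mxdotC addrC; congr (_ * _).
by rewrite fmorphV rmorph_nat.
Qed.

Lemma kinetic_real n N (x : phase R n N) :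
  (kinetic x)%:C =
  2^-1 * mxdot x.2 ((x.2 : 'M[R[i]]_(n * N, n)) *m invmx x.1).
Proof.
apply: real_Re; rewrite rmorphM /= fmorphV rmorph_nat mxdotC; congr (_ * _).
rewrite /mxdot trmx_mul map_mxM trmx_inv map_invmx herm_adj.
by rewrite -mulmxA mxtrace_mulC mulmxA.
Qed.

End Matrices.

Section Functions.
Variable R : realType.
Local Open Scope ereal_scope.

Definition F0 n N (x : phase R n N) : \bar R :=
  if `[< pdmx x.1 >] then (kinetic x)%:E else +oo.

Definition F n N (x : phase R n N) : \bar R :=
  if `[< pdmx x.1 >] then (kinetic x)%:E
  else if `[< psdmx x.1 >] then
    ereal_inf [set limn_einf (fun l => (kinetic (s l))%:E) |
      s in [set s : nat -> phase R n N |
             (forall l, pdmx (s l).1) /\ s @ \oo --> x]]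
  else +oo.

(* The dual sum on \bar R has -oo + +oo = +oo, which is the convention of
   convex analysis for functions that may take both infinite values. *)
Definition convex_efun (E : lmodType R) (f : E -> \bar R) : Prop :=
  forall (x y : E) (t : R), (0 <= t <= 1)%R ->
    f (t *: x + (1 - t) *: y)%R <= (t%:E * f x + (1 - t)%:E * f y)%dE.

Definition is_cvx_lsc_envelope n N (f0 f : phase R n N -> \bar R) : Prop :=
  [/\ convex_efun f, lower_semicontinuous f, (forall x, f x <= f0 x) &
    forall g : phase R n N -> \bar R,
      convex_efun g -> lower_semicontinuous g -> (forall x, g x <= f0 x) ->
      forall x, g x <= f x].

Definition legendre n N (f : phase R n N -> \bar R) (ab : phase R n N) :
    \bar R :=
  ereal_sup [set (hdot ab.1 x.1 + rdot ab.2 x.2)%:E - f x |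
              x in [set: phase R n N]].

End Functions.

(* Main.v *)
Require Import Defs.
From mathcomp Require Import all_boot all_order all_algebra complex.
From mathcomp Require Import all_classical all_reals all_analysis.
From mathcomp Require Import ring.
Import numFieldNormedType.Exports.
Import Order.TTheory GRing.Theory Num.Theory.
Local Open Scope classical_set_scope.
Local Open Scope ring_scope.
Local Open Scope complex_scope.
Local Open Scope sesquilinear_scope.

Set Implicit Arguments.
Unset Strict Implicit.
Unset Printing Implicit Defensive.

(** The function F is the support function of the closed convex set
      K = { (a, b) : a + b^H b / 2 <= 0 },
    that is, F x = G x := sup { <a; rho> + b . m : (a, b) in K } for every
    x = (rho, m); see [F_support_fun].  Here ^H is the conjugate transpose.
    Everything else follows from this formula.

    When rho = V V^H and m = c rho, every (a, b) in K satisfies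
      <a; rho> + b . m <= - |b V|^2 / 2 + Re <b V; c V> <= |c V|^2 / 2,
    with equality at (a, b) = (- c^H c / 2, c), so G x = |c V|^2 / 2
    ([support_fun_gram]).  For a positive definite rho, taking V V^H = rho and
    c = m rho^-1 shows that G is the kinetic energy.  If rho is not positive
    semidefinite, a vector v with <v; rho v> < 0 gives the points
    (- t v v^H, 0) of K, along which the pairing is unbounded, so G x = +oo.
    If rho is positive semidefinite but singular, F x >= G x because G, a
    supremum of continuous functions, is lower semicontinuous; and F x <= G x
    because along rho + e 1, with m fixed, G does not exceed G x: tr a <= 0 for
    all (a, b) in K.

    As a supremum of continuous linear functions, one of which is 0, G is
    convex, lower semicontinuous and nonnegative.  A lower semicontinuous
    function that is <= F0 is <= F: this is clear unless rho is singular and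
    positive semidefinite, where it results from passing to the limit along
    the sequences that define F.  Finally, for (a, b) in K the pairing is <= G,
    with equality at x = 0, so the Legendre transform is 0; outside K there is
    v with <v; (a + b^H b / 2) v> > 0, and along (t v v^H, t b v v^H) the
    difference of the pairing and G is t <v; (a + b^H b / 2) v>, which is
    unbounded. *)

(** * Hermitian matrices and traces *)

Section HermitianMatrices.
Variable R : realType.
Implicit Types p q k n : nat.

Lemma trmxC_mul p q k (A : 'M[R[i]]_(p, q)) (B : 'M[R[i]]_(q, k)) :
  (A *m B) ^t* = B ^t* *m A ^t*.
Proof. by rewrite trmx_mul map_mxM. Qed.

Lemma trmxC_B p q (A B : 'M[R[i]]_(p, q)) : (A - B) ^t* = A ^t* - B ^t*.
Proof. by rewrite linearB /= map_mxB. Qed.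

Lemma hermsymmxP n (A : 'M[R[i]]_n) : reflect (A ^t* = A) (A \is hermsymmx).
Proof.
rewrite is_hermitianmxE expr0 scale1r.
by apply: (iffP eqP) => [{2}->|->].
Qed.

Lemma mxdot_ge0 p q (X : 'M[R[i]]_(p, q)) : 0 <= mxdot X X.
Proof.
rewrite /mxdot /mxtrace; apply: sumr_ge0 => i _; rewrite mxE.
by apply: sumr_ge0 => j _; rewrite !mxE mulrC -normCK exprn_ge0.
Qed.

Lemma mxdot_eq0 p q (X : 'M[R[i]]_(p, q)) : (mxdot X X == 0) = (X == 0).
Proof.
apply/idP/eqP => [|->]; last by rewrite /mxdot mulmx0 mxtrace0.
have nn i j : 0 <= X ^t* i j * X j i by rewrite !mxE mulrC -normCK exprn_ge0.
rewrite /mxdot /mxtrace psumr_eq0 => [/allP X0|i _]; last first.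
  by rewrite mxE; apply: sumr_ge0.
apply/matrixP => j i; have := X0 i (mem_index_enum _).
rewrite mxE psumr_eq0// => /allP/(_ j (mem_index_enum _)).
by rewrite !mxE mulf_eq0 conjC_eq0 orbb => /eqP.
Qed.

Lemma mxdotBB p q (X Y : 'M[R[i]]_(p, q)) :
  mxdot (X - Y) (X - Y) = mxdot X X - mxdot X Y - mxdot Y X + mxdot Y Y.
Proof.
rewrite /mxdot trmxC_B mulmxBl !mulmxBr !raddfB /=; ring.
Qed.

(** A trace of the form tr (V^H A V) is the sum of the values of the quadratic
    form of A on the columns of V. *)
Lemma psdmx_trace_ge0 n k (A : 'M[R[i]]_n) (V : 'M[R[i]]_(n, k)) :
  psdmx A -> 0 <= \tr (V ^t* *m A *m V).
Proof.
case=> _ A0; rewrite /mxtrace; apply: sumr_ge0 => i _.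
suff -> : (V ^t* *m A *m V) i i = ((col i V) ^t* *m A *m col i V) 0 0 by [].
have -> : (col i V) ^t* = row i (V ^t*) by apply/matrixP => ? ?; rewrite !mxE.
by rewrite -row_mul colE mulmxA -colE -row_mul !mxE.
Qed.

Lemma psdmx_gram n k (V : 'M[R[i]]_(n, k)) : psdmx (V *m V ^t*).
Proof.
split; first by apply/hermsymmxP; rewrite trmxC_mul trmxCK.
move=> v; rewrite -trace_mx11 mulmxA -[X in _ *m X *m _]trmxCK -mulmxA.
have := mxdot_ge0 (V ^t* *m v).
by rewrite /mxdot trmxC_mul !trmxCK.
Qed.

(** By the spectral theorem: V is the adjoint of the diagonalizing unitary
    matrix times the square root of the diagonal. *)
Lemma psdmx_factor n (A : 'M[R[i]]_n) :
  psdmx A -> exists V : 'M[R[i]]_n, A = V *m V ^t*.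
Proof.
move=> [hA A0].
have /orthomx_spectralP := hermitian_normalmx hA.
set P := spectralmx A; set d := spectral_diag A => AE.
have uP : P \is unitarymx := spectral_unitarymx A.
have PP : P *m P ^t* = 1%:M by apply/unitarymxP.
rewrite (invmx_unitary uP) in AE.
(* d 0 i is the value of the quadratic form of A on the i-th eigenvector. *)
have d0 i : 0 <= d 0 i.
  have := A0 ((row i P) ^t*); rewrite trmxCK => /le_trans; apply.
  have -> : (row i P) ^t* = col i (P ^t*) by apply/matrixP => ? ?; rewrite !mxE.
  rewrite colE mulmxA -colE -!row_mul.
  rewrite {1}AE !mulmxA PP mul1mx -mulmxA PP mulmx1 !mxE eqxx mulr1n //.
pose s : 'rV[R[i]]_n := \row_i sqrtC (d 0 i).
exists (P ^t* *m diag_mx s); rewrite trmxC_mul trmxCK -!mulmxA.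
rewrite {1}AE -!mulmxA; congr (_ *m _); rewrite mulmxA; congr (_ *m _).
have -> : (diag_mx s) ^t* = diag_mx s.
  rewrite tr_diag_mx map_diag_mx; congr diag_mx.
  apply/rowP => i; rewrite !mxE; exact/conj_Creal/sqrtC_real.
rewrite mulmx_diag; congr diag_mx; apply/rowP => i.
by rewrite !mxE -expr2 sqrtCK.
Qed.

Lemma pdmx_psdmx n (A : 'M[R[i]]_n) : pdmx A -> psdmx A.
Proof.
case=> hA A0; split=> // v; have [->|v0] := eqVneq v 0; last exact/ltW/A0.
by rewrite mulmx0 mxE.
Qed.

Lemma pdmx_unit n (A : 'M[R[i]]_n) : pdmx A -> A \in unitmx.
Proof.
case=> /hermsymmxP hA A0; rewrite -row_free_unit -kermx_eq0.
apply/eqP/row_matrixP => i; rewrite row0; apply/eqP; apply: contraT => v0.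
set v := row i _ in v0.
have vA : v *m A = 0 by rewrite -row_mul mulmx_ker row0.
(* A nonzero row v of the left kernel of A would be a zero of its form. *)
have := A0 (v ^t*); rewrite trmxCK vA mul0mx mxE ltxx; apply.
by apply: contra v0 => /eqP v0; rewrite -[v]trmxCK v0 trmx0 map_mx0.
Qed.

Lemma pdmx_add_scalar n (A : 'M[R[i]]_n) (e : R) :
  psdmx A -> 0 < e -> pdmx (A + e%:C%:M).
Proof.
move=> [/hermsymmxP hA A0] e0; split.
  apply/hermsymmxP; rewrite linearD /= map_mxD hA tr_scalar_mx map_scalar_mx /=.
  by congr (_ + _%:M); exact: conjc_real.
move=> v v0; rewrite mulmxDr mulmxDl mxE ltr_wpDl//.
rewrite mul_mx_scalar -scalemxAl mxE -trace_mx11 -/(mxdot v v).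
by rewrite mulr_gt0 ?ltcR// lt_def mxdot_eq0 v0 mxdot_ge0.
Qed.

Lemma trace_quadZ n k (M : 'M[R[i]]_n) (s : R) (V : 'M[R[i]]_(n, k)) :
  \tr ((s%:C *: V) ^t* *m M *m (s%:C *: V)) =
  (s ^+ 2)%:C * \tr (V ^t* *m M *m V).
Proof.
have cs : Num.conj s%:C = s%:C :> R[i] by exact: conjc_real.
rewrite [(_ *: V)^T]linearZ /= map_mxZ /= [X in X *: _]cs.
rewrite -scalemxAr -!scalemxAl !mxtraceZ.
by rewrite mulrA -rmorphM.
Qed.

(** The quadratic form of a Hermitian matrix is real, so that failing to be
    nonnegative means being negative. *)
Lemma not_psdmx n (M : 'M[R[i]]_n) : M ^t* = M -> ~ psdmx M ->
  exists v : 'cV[R[i]]_n, complex.Re (\tr (v ^t* *m M *m v)) < 0.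
Proof.
move=> hM nM; apply: contrapT => /forallNP H; apply: nM; split.
  exact/hermsymmxP.
move=> v; have /negP := H v; rewrite -leNgt -trace_mx11.
suff <- : (complex.Re (\tr (v ^t* *m M *m v)))%:C = \tr (v ^t* *m M *m v).
  by rewrite lecR.
apply: real_Re; rewrite -trace_map_mx -mxtrace_tr map_trmx trmxC_mul.
by rewrite trmxC_mul trmxCK hM mulmxA.
Qed.

Lemma psdmx0 n : psdmx (0 : 'M[R[i]]_n).
Proof. by have := psdmx_gram (0 : 'M[R[i]]_(n, 1)); rewrite mul0mx. Qed.

(** Matrices equal to their adjoint are in the range of the coercion from
    [herm]. *)
Lemma exists_herm n (A : 'M[R[i]]_n) :
  A ^t* = A -> exists a : herm R n, (a : 'M[R[i]]_n) = A.
Proof.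
by move=> hA; exists (@Herm R n A (introT (hermsymmxP A) hA)).
Qed.

Lemma half_gram_adj p q (c : 'M[R[i]]_(p, q)) :
  (2^-1 *: (c ^t* *m c)) ^t* = 2^-1 *: (c ^t* *m c).
Proof.
rewrite [(_ *: _)^T]linearZ /= map_mxZ /= trmxC_mul trmxCK.
by congr (_ *: _); exact: (etrans (fmorphV _ _) (congr1 _ (rmorph_nat _ _))).
Qed.

Lemma ReZ (t : R) (z : R[i]) : complex.Re (t%:C * z) = t * complex.Re z.
Proof. by case: z => u v /=; rewrite mul0r subr0. Qed.

Lemma rdotE p q (b m : cmx R p q) : rdot b m = complex.Re (mxdot b m).
Proof.
rewrite /rdot -[mxdot m b]mxdotC.
have -> : (2^-1 : R[i]) = (2^-1 : R)%:C by rewrite fmorphV rmorph_nat.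
by case: (mxdot b m) => u v /=; rewrite mul0r subr0; field.
Qed.

(** The dual bound, from - (a + b^H b / 2) >= 0 and |c V - b V|^2 >= 0. *)
Lemma trace_young p q k (a : 'M[R[i]]_p) (b c : 'M[R[i]]_(q, p))
    (V : 'M[R[i]]_(p, k)) : npsdmx (a + 2^-1 *: (b ^t* *m b)) ->
  \tr (V ^t* *m a *m V)
    + 2^-1 * (mxdot (b *m V) (c *m V) + mxdot (c *m V) (b *m V))
  <= 2^-1 * mxdot (c *m V) (c *m V).
Proof.
move=> /psdmx_trace_ge0 - /(_ _ V) H.
have : 0 <= 2^-1 * mxdot (c *m V - b *m V) (c *m V - b *m V).
  by rewrite mulr_ge0 ?mxdot_ge0 ?invr_ge0 ?ler0n.
move: H; rewrite mulmxN mulNmx raddfN /= mulmxDr mulmxDl raddfD /=.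
rewrite -scalemxAr -scalemxAl mxtraceZ.
have -> : V ^t* *m (b ^t* *m b) *m V = (b *m V) ^t* *m (b *m V).
  by rewrite trmxC_mul !mulmxA.
rewrite -/(mxdot _ _) mxdotBB => H1 H2; rewrite -subr_ge0.
apply: le_trans (addr_ge0 H1 H2) _.
by rewrite le_eqVlt; apply/orP; left; apply/eqP; field.
Qed.

End HermitianMatrices.

(** * Extended reals and lower limits of sequences *)

Section LowerLimits.
Variable R : realType.
Local Open Scope ereal_scope.

Lemma ge_all_multiples_pinfty (e : \bar R) (c : R) : (0 < c)%R ->
  (forall t, (0 <= t)%R -> (t * c)%:E <= e) -> e = +oo.
Proof.
move=> c0 H; have := H 0%R (lexx 0%R); rewrite mul0r.
case: e H => [r|//|//] H; rewrite lee_fin => r0.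
have := H ((r + 1) / c)%R; rewrite lee_fin divfK ?gt_eqF//.
have -> : (r + 1 <= r)%R = false by apply/negbTE; rewrite -ltNge ltrDl.
by move=> /(_ (divr_ge0 (addr_ge0 r0 ler01) (ltW c0))).
Qed.

Lemma ereal_lt_fin_between (u v : \bar R) : u < v ->
  exists r : R, u < r%:E < v.
Proof.
case: u v => [u| |] [v| |] //; rewrite ?lte_fin => uv.
- by exists ((u + v) / 2)%R; rewrite !lte_fin !midf_lt.
- by exists (u + 1)%R; rewrite lte_fin ltrDl ltr01 ltry.
- by exists (v - 1)%R; rewrite ltNyr lte_fin gtrBl ltr01.
- by exists 0%R; rewrite ltNyr ltry.
Qed.

(** Semicontinuity along a sequence of values that dominates g. *)
Lemma lsc_le_limn_einf (X : topologicalType) (g : X -> \bar R) (s : nat -> X)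
    (x : X) (u : nat -> \bar R) :
  lower_semicontinuous g -> s @ \oo --> x -> (forall k, g (s k) <= u k) ->
  g x <= limn_einf u.
Proof.
move=> lg sx gu; rewrite leNgt; apply/negP => /ereal_lt_fin_between[r /andP[]].
rewrite ltNge => + /lg[V xV Vr]; apply/negP; rewrite negbK.
have [k0 _ sV] := sx _ xV.
rewrite limn_einf_lim; apply: lime_ge; first exact: is_cvg_einfs.
exists k0 => // k /= k0k; apply: le_ereal_inf_tmp => _ [l /= kl <-].
by apply: le_trans (gu l); apply/ltW/Vr/sV => /=; exact: leq_trans kl.
Qed.

Lemma limn_einf_le (u : nat -> \bar R) e :
  (forall k, u k <= e) -> limn_einf u <= e.
Proof.
move=> ue; rewrite limn_einf_lim; apply: lime_le; first exact: is_cvg_einfs.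
apply: nearW => k; apply: le_trans (ue k).
by apply: ereal_inf_lbound; exists k => /=.
Qed.

End LowerLimits.

(** * The support function of the dual feasible set *)

Section SupportFunction.
Variables (R : realType) (n N : nat).
Implicit Types ab x y : phase R n N.

(** The real bilinear form <a; rho> + b . m that pairs the phase space with
    itself. *)
Definition pairing ab x : R := hdot ab.1 x.1 + rdot ab.2 x.2.

(** Membership of (a, b) in the convex set K of the pairs such that
    a + b^H b / 2 <= 0. *)
Definition dual_feasible ab : Prop :=
  npsdmx ((ab.1 : 'M[R[i]]_n) + 2^-1 *: (ab.2 ^t* *m ab.2)).

(** The support function of [dual_feasible]. *)
Definition support_fun x : \bar R :=
  ereal_sup [set (pairing ab x)%:E | ab in dual_feasible].

Lemma pairingE ab x :
  pairing ab x = complex.Re (mxdot ab.1 x.1 + mxdot ab.2 x.2).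
Proof. by rewrite /pairing rdotE /hdot raddfD. Qed.

Lemma pairing_complex ab x : (pairing ab x)%:C =
  mxdot ab.1 x.1 + 2^-1 * (mxdot ab.2 x.2 + mxdot x.2 ab.2).
Proof. by rewrite rmorphD /= hdot_real rdot_real. Qed.

Lemma pairingDZ ab (t s : R) x y :
  pairing ab (t *: x + s *: y) = t * pairing ab x + s * pairing ab y.
Proof.
have dotDZ p q (c u v : 'M[R[i]]_(p, q)) :
    mxdot c (t%:C *: u + s%:C *: v) = t%:C * mxdot c u + s%:C * mxdot c v.
  by rewrite /mxdot mulmxDr -!scalemxAr mxtraceD !mxtraceZ.
rewrite !pairingE /= [X in X + _]dotDZ [X in _ + X]dotDZ !raddfD /= !ReZ; ring.
Qed.

Lemma dual_feasible0 : dual_feasible 0.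
Proof.
change (npsdmx (0 + 2^-1 *: ((0 : 'M[R[i]]_(n * N, n)) ^t* *m 0))).
by rewrite mulmx0 scaler0 addr0 /npsdmx oppr0; exact: psdmx0.
Qed.

Lemma pairing_gram ab x k (V : 'M[R[i]]_(n, k)) (c : 'M[R[i]]_(n * N, n)) :
  (x.1 : 'M[R[i]]_n) = V *m V ^t* ->
  (x.2 : 'M[R[i]]_(n * N, n)) = c *m (V *m V ^t*) ->
  (pairing ab x)%:C = \tr (V ^t* *m ab.1 *m V) + 2^-1 *
    (mxdot ((ab.2 : 'M[R[i]]_(n * N, n)) *m V) (c *m V) +
     mxdot (c *m V) ((ab.2 : 'M[R[i]]_(n * N, n)) *m V)).
Proof.
move=> x1 x2; rewrite pairing_complex x1 x2 /mxdot herm_adj.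
congr (_ + _ * (_ + _)).
- by rewrite mulmxA mxtrace_mulC mulmxA.
- by rewrite trmxC_mul !mulmxA mxtrace_mulC !mulmxA.
- by rewrite !trmxC_mul trmxCK -!mulmxA mxtrace_mulC !mulmxA.
Qed.

(** The supremum is attained at (- c^H c / 2, c). *)
Lemma support_fun_gram x k (V : 'M[R[i]]_(n, k)) (c : 'M[R[i]]_(n * N, n)) :
  (x.1 : 'M[R[i]]_n) = V *m V ^t* ->
  (x.2 : 'M[R[i]]_(n * N, n)) = c *m (V *m V ^t*) ->
  support_fun x = (complex.Re (2^-1 * mxdot (c *m V) (c *m V)))%:E.
Proof.
move=> x1 x2.
have real : (complex.Re (2^-1 * mxdot (c *m V) (c *m V)))%:C =
    2^-1 * mxdot (c *m V) (c *m V).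
  by apply: real_Re; rewrite rmorphM /= fmorphV rmorph_nat mxdotC.
apply/eqP; rewrite eq_le; apply/andP; split.
  apply: ge_ereal_sup => _ [ab fab <-]; rewrite lee_fin -lecR real.
  by rewrite (pairing_gram _ x1 x2); exact: trace_young.
have hc : (- (2^-1 *: (c ^t* *m c))) ^t* = - (2^-1 *: (c ^t* *m c)).
  by rewrite linearN /= map_mxN half_gram_adj.
have [a aE] := exists_herm hc.
apply: ereal_sup_ubound; exists (a, c).
  rewrite /dual_feasible /= aE addNr /npsdmx oppr0; exact: psdmx0.
congr EFin; apply: (@complexI R); rewrite real (pairing_gram _ x1 x2) /= aE.
rewrite mulmxN mulNmx raddfN /= -scalemxAr -scalemxAl mxtraceZ.
have -> : V ^t* *m (c ^t* *m c) *m V = (c *m V) ^t* *m (c *m V).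
  by rewrite trmxC_mul !mulmxA.
by rewrite -/(mxdot _ _); field.
Qed.

Lemma support_fun_pd x : pdmx x.1 -> support_fun x = (kinetic x)%:E.
Proof.
move=> px; have [V VE] := psdmx_factor (pdmx_psdmx px).
pose c : 'M[R[i]]_(n * N, n) := (x.2 : 'M[R[i]]_(n * N, n)) *m invmx x.1.
have x2 : (x.2 : 'M[R[i]]_(n * N, n)) = c *m (V *m V ^t*).
  by rewrite -VE /c mulmxKV// pdmx_unit.
have -> : kinetic x = complex.Re (2^-1 * mxdot x.2 c) by [].
rewrite (support_fun_gram VE x2); clearbody c; congr (complex.Re (_ * _))%:E.
rewrite x2 /mxdot !trmxC_mul trmxCK.
by rewrite -!mulmxA [RHS]mxtrace_mulC !mulmxA.
Qed.

Lemma support_fun_ge0 x : (0 <= support_fun x)%E.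
Proof.
apply: ereal_sup_ubound; exists 0; first exact: dual_feasible0.
by rewrite pairingE /mxdot /= !trmx0 !map_mx0 !mul0mx !mxtrace0 addr0.
Qed.

Lemma support_fun_not_psd x : ~ psdmx x.1 -> support_fun x = +oo%E.
Proof.
move=> /(not_psdmx (herm_adj _))[v v0].
apply: (@ge_all_multiples_pinfty _ _
  (- complex.Re (\tr (v ^t* *m x.1 *m v)))).
  by rewrite oppr_gt0.
move=> t t0; pose V : 'cV[R[i]]_n := (Num.sqrt t)%:C *: v.
have hV : (- (V *m V ^t*)) ^t* = - (V *m V ^t*).
  by rewrite linearN /= map_mxN trmxC_mul trmxCK.
(* The points (- t v v^H, 0), written with V = sqrt t v, are dual feasible. *)
have [a aE] := exists_herm hV.
apply: ereal_sup_ubound; exists (a, 0).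
  rewrite /dual_feasible /= aE mulmx0 scaler0 addr0 /npsdmx opprK.
  exact: psdmx_gram.
congr EFin; rewrite pairingE /= {2}/mxdot trmx0 map_mx0 mul0mx mxtrace0 addr0.
rewrite /mxdot herm_adj aE mulNmx raddfN /= mxtrace_mulC mulmxA.
rewrite [\tr (_ *m V *m _)]mxtrace_mulC mulmxA.
rewrite [\tr _](trace_quadZ x.1 (Num.sqrt t) v).
by rewrite sqr_sqrtr// raddfN /= ReZ mulrN.
Qed.

(** Adding a nonnegative multiple of the identity to rho does not raise the
    support function, because tr a <= 0 for all dual feasible (a, b). *)
Lemma support_fun_perturb x y (e : R) : 0 <= e ->
  (y.1 : 'M[R[i]]_n) = (x.1 : 'M[R[i]]_n) + e%:C%:M -> y.2 = x.2 ->
  (support_fun y <= support_fun x)%E.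
Proof.
move=> e0 y1 y2; apply: ge_ereal_sup => _ [ab fab <-].
apply: (@le_trans _ _ (pairing ab x)%:E); last first.
  by apply: ereal_sup_ubound; exists ab.
rewrite lee_fin -lecR !pairing_complex y1 y2 lerD2r /mxdot mulmxDr raddfD /=.
rewrite gerDl mul_mx_scalar mxtraceZ herm_adj mulr_ge0_le0 ?ler0c//.
(* The trace of a is the left-hand side of the dual bound at V = 1, c = 0. *)
have := trace_young (0 : 'M[R[i]]_(n * N, n)) (1%:M : 'M[R[i]]_n) fab.
rewrite mul0mx /mxdot !(mulmx0, mul0mx, mulmx1, trmx0, map_mx0, mxtrace0).
rewrite addr0 mulr0 addr0.
by rewrite trmx1 map_mx1 mul1mx.
Qed.

End SupportFunction.

(** * Continuity on the phase space *)

Section Topology.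
Variable R : realType.

Lemma Re_continuous : continuous (@complex.Re R : R[i] -> R).
Proof.
move=> z; apply/(@cvgrPdist_lt _ _ _ _ (@nbhs_filter R[i] z)) => e e0.
exists e%:C; first by rewrite /= ltcR.
move=> w /= zw; rewrite -ltcR -raddfB.
exact: le_lt_trans (normc_ge_Re _) zw.
Qed.

Lemma real_complex_continuous : continuous (fun t : R => t%:C : R[i]).
Proof.
move=> t; apply/(@cvgrPdist_lt R[i] R[i]^o) => -[e e']; rewrite ltcE /=.
move=> /andP[/eqP -> e0]; exists e => // s /= ts.
by rewrite -rmorphB normc_def /= expr0n addr0 sqrtr_sqr ltcR.
Qed.

Lemma cmx_entry_continuous p q (i : 'I_p) (j : 'I_q) :
  continuous (fun m : cmx R p q => m i j : R[i]).
Proof.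
move=> m A mA; exists (fun i' j' => if (i' == i) && (j' == j) then A else setT).
  move=> i' j'; case: ifP => [/andP[/eqP -> /eqP ->]//|_]; exact: filterT.
by move=> m' /(_ i j); rewrite !eqxx.
Qed.

(** Entrywise convergence implies convergence. *)
Lemma cvg_cmx p q (F : set_system (cmx R p q)) (m : cmx R p q) : Filter F ->
  (forall i j, (fun m' : cmx R p q => m' i j : R[i]) @ F --> (m i j : R[i])) ->
  F --> m.
Proof.
move=> FF H A [P mP PA].
suff : \forall m' \near F, forall i j, P i j ((m' : cmx R p q) i j).
  by apply: filterS => m'; exact: PA.
apply: filter_forall => i; apply: filter_forall => j.
exact: H (mP i j).
Qed.

Lemma cvg_mxdot p q (c : 'M[R[i]]_(p, q)) (T : Type) (F : set_system T)
    (f : T -> cmx R p q) (m : cmx R p q) : Filter F ->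
  f @ F --> m -> (fun t => mxdot c (f t) : R[i]) @ F --> (mxdot c m : R[i]).
Proof.
move=> FF fm.
have E (m' : cmx R p q) :
    mxdot c m' = \sum_i \sum_j c ^t* i j * (m' j i : R[i]).
  by apply: eq_bigr => i _; rewrite mxE.
have addC_continuous :=
  @pseudometric_normed_Zmodule.add_continuous R[i] R[i]^o.
rewrite E; under eq_fun do rewrite E.
apply: cvg_big => [|i _]; first exact: addC_continuous.
apply: cvg_big => [|j _]; first exact: addC_continuous.
apply: cvgMl_tmp.
apply: (@cvg_comp _ _ _ f (fun m' : cmx R p q => m' j i : R[i]) _ (nbhs m)).
  exact: fm.
exact: cmx_entry_continuous.
Qed.

End Topology.

(** * Identification of F, its envelope property and its Legendre transform *)

Section Envelope.
Variables (R : realType) (n N : nat).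
Local Open Scope ereal_scope.
Implicit Types (x : phase R n N).

Lemma pairing_continuous (ab : phase R n N) :
  continuous (pairing ab : phase R n N -> R).
Proof.
move=> x.
have -> : pairing ab = fun y : phase R n N =>
    (complex.Re (mxdot ab.1 y.1) + complex.Re (mxdot ab.2 y.2))%R.
  by apply/funext => y; rewrite pairingE raddfD.
have c1 : (fun y : phase R n N => hermval y.1) @ nbhs x --> hermval x.1.
  apply: (@cvg_comp _ _ _ fst (@hermval R n) _ (nbhs x.1)).
    exact: cvg_fst.
  exact: initial_continuous.
have c2 : (fun y : phase R n N => y.2) @ nbhs x --> x.2 by exact: cvg_snd.
have FF := @nbhs_filter _ x.
apply: (@cvgD _ R^o).
  have dot1 := @cvg_mxdot R _ _ ab.1 _ _ _ _ FF c1.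
  apply: (@cvg_comp _ _ _ _ (@complex.Re R) _ _ _ dot1).
  exact: Re_continuous.
have dot2 := @cvg_mxdot R _ _ ab.2 _ _ _ _ FF c2.
apply: (@cvg_comp _ _ _ _ (@complex.Re R) _ _ _ dot2).
exact: Re_continuous.
Qed.

Lemma cvg_herm (F : set_system (herm R n)) (rho : herm R n) : Filter F ->
  (@hermval R n) @ F --> hermval rho -> F --> rho.
Proof.
move=> FF H A [_ [[B Bop <-] Bs sBA]].
apply: filterS sBA _; apply: H; exact: open_nbhs_nbhs.
Qed.

Lemma support_fun_lsc : lower_semicontinuous (@support_fun R n N).
Proof.
move=> x a /ereal_sup_gt[_ [ab fab <-]]; rewrite lte_fin => ax.
exists [set y | (a < pairing ab y)%R].
  apply: (@pairing_continuous ab x [set r | (a < r)%R]).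
  by apply: open_nbhs_nbhs; split => //; exact: open_gt.
move=> y /= ay; apply: lt_le_trans (ereal_sup_ubound _); last by exists ab.
by rewrite lte_fin.
Qed.

Lemma support_fun_convex : convex_efun (@support_fun R n N).
Proof.
move=> x y t /andP[t0 t1]; apply: ge_ereal_sup => _ [ab fab <-].
rewrite pairingDZ; have s0 : (0 <= 1 - t)%R by rewrite subr_ge0.
(* Both terms are nonnegative, so the dual sum is the usual one. *)
rewrite DualAddTheoryNumDomain.dual_addeE_def; last first.
  by apply: ge0_adde_def; rewrite inE mule_ge0 ?lee_fin ?support_fun_ge0.
rewrite EFinD !EFinM; apply: leeD; apply: lee_wpmul2l; rewrite ?lee_fin//.
- by apply: ereal_sup_ubound; exists ab.
- by apply: ereal_sup_ubound; exists ab.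
Qed.

(** The approximating sequence is (rho + 1 / (l + 1), m), where the scalar stands
    for a multiple of the identity matrix. *)
Lemma pd_approx x : psdmx x.1 -> exists s : nat -> phase R n N,
  [/\ forall l, pdmx (s l).1, s @ \oo --> x &
      forall l, support_fun (s l) <= support_fun x].
Proof.
move=> px; pose A l : 'M[R[i]]_n := ((x.1 : 'M[R[i]]_n) + (harmonic l)%:C%:M)%R.
have pA l : pdmx (A l) by exact: pdmx_add_scalar (harmonic_gt0 _).
have hA l : ((A l) ^t* = A l)%R by apply/hermsymmxP; exact: (pA l).1.
have [rho rhoE] := choice (fun l => exists_herm (hA l)).
exists (fun l => (rho l, x.2)); split => [l||l].
- by rewrite /= rhoE.
- rewrite [x]surjective_pairing.
  apply: (@cvg_pair _ _ _ _ (nbhs x.1) (nbhs x.2)); last exact: cvg_cst.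
  apply: (@cvg_herm (rho @ \oo)).
  apply: (@cvg_cmx _ _ _ (@hermval R n @ (rho @ \oo))) => i j.
  have E l : ((hermval (rho l) : 'M[R[i]]_n) i j) =
      ((x.1 : 'M[R[i]]_n) i j + (harmonic l)%:C * (i == j)%:R)%R.
    have := congr1 (fun M : 'M[R[i]]_n => M i j) (rhoE l).
    by rewrite !mxE mulr_natr.
  have h0 : (fun l => (harmonic l : R)%:C : R[i]) @ \oo --> ((0 : R)%:C : R[i]).
    apply: (@cvg_comp nat R R[i] (@harmonic R) (fun t : R => t%:C)
      \oo (nbhs (0%R : R))).
      exact: cvg_harmonic.
    exact: real_complex_continuous.
  have : (fun l => (x.1 : 'M[R[i]]_n) i j +
      (harmonic l)%:C * (i == j)%:R)%R @ \oo -->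
      ((x.1 : 'M[R[i]]_n) i j + (0 : R)%:C * (i == j)%:R)%R.
    apply: (@cvgD _ R[i]^o); first exact: cvg_cst.
    exact: (@cvgMr_tmp R[i] _ _ _ _ _ _ h0).
  by rewrite mul0r addr0 -(funext E).
- exact: (support_fun_perturb (x := x) (y := (rho l, x.2))
    (harmonic_ge0 l) (rhoE l) erefl).
Qed.

Lemma F_support_fun x : F x = support_fun x.
Proof.
rewrite /F; case: asboolP => [px|npx]; first by rewrite support_fun_pd.
case: asboolP => [sx|nsx]; last by rewrite support_fun_not_psd.
apply/eqP; rewrite eq_le; apply/andP; split; last first.
  apply: le_ereal_inf_tmp => _ [s [ps sx'] <-].
  apply: (lsc_le_limn_einf support_fun_lsc sx') => l.
  by rewrite support_fun_pd.
have [s [ps sx' le]] := pd_approx sx.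
apply: le_trans (ereal_inf_lbound _) _; first by exists s.
by apply: limn_einf_le => l; rewrite -support_fun_pd.
Qed.

(** Maximality at a singular rho: a lower semicontinuous minorant of [F0] passes
    to the limit along every sequence in the infimum that defines F. *)
Lemma F_envelope : is_cvx_lsc_envelope (@F0 R n N) (@F R n N).
Proof.
have FE : @F R n N = @support_fun R n N by apply/funext/F_support_fun.
split.
- by rewrite FE; exact: support_fun_convex.
- by rewrite FE; exact: support_fun_lsc.
- by move=> x; rewrite /F /F0; case: asboolP => // _; rewrite leey.
move=> g _ glsc gF0 x.
have gpd (y : phase R n N) : pdmx y.1 -> g y <= (kinetic y)%:E.
  by move=> py; have := gF0 y; rewrite /F0; case: asboolP.
rewrite /F; case: asboolP => [/gpd//|_].
case: asboolP => [_|_]; last by rewrite leey.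
apply: le_ereal_inf_tmp => _ [s [ps sx] <-].
by apply: (lsc_le_limn_einf glsc sx) => l; exact: gpd.
Qed.

Lemma legendre_support_fun (ab : phase R n N) :
  legendre (@support_fun R n N) ab =
  if `[< dual_feasible ab >] then 0 else +oo.
Proof.
case: asboolP => [fab|nfab].
  apply/eqP; rewrite eq_le; apply/andP; split.
    apply: ge_ereal_sup => _ [x _ <-].
    have : (pairing ab x)%:E <= support_fun x.
      by apply: ereal_sup_ubound; exists ab.
    by rewrite sube_le0.
  (* The value 0 is attained at the origin, which is V V^H and c V V^H for
     V = 0 and c = 0. *)
  apply: ereal_sup_ubound; exists 0%R => //.
  have x1 : ((0%R : herm R n) : 'M[R[i]]_n) =
      ((0 : 'M[R[i]]_n) *m (0 : 'M[R[i]]_n) ^t*)%R.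
    by rewrite mul0mx.
  have x2 : ((0%R : cmx R (n * N) n) : 'M[R[i]]_(n * N, n)) =
      ((0 : 'M[R[i]]_(n * N, n)) *m
        ((0 : 'M[R[i]]_n) *m (0 : 'M[R[i]]_n) ^t*))%R.
    by rewrite mul0mx.
  rewrite (support_fun_gram (x := 0%R : phase R n N) x1 x2).
  rewrite -/(pairing ab 0%R) pairingE /mxdot /=.
  by rewrite !mulmx0 !mxtrace0 !mulr0 addr0 subee.
set M : 'M[R[i]]_n :=
  ((ab.1 : 'M[R[i]]_n) + 2^-1 *: (ab.2 ^t* *m ab.2))%R in nfab.
have hM : ((- M) ^t* = - M)%R.
  rewrite linearN /= map_mxN /M [(_ + _)^T]linearD /= map_mxD.
  by rewrite herm_adj half_gram_adj.
have [v v0] := not_psdmx hM nfab.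
apply: (@ge_all_multiples_pinfty _ _
  (- complex.Re (\tr (v ^t* *m (- M) *m v)))%R).
  by rewrite oppr_gt0.
move=> t t0; pose V : 'cV[R[i]]_n := ((Num.sqrt t)%:C *: v)%R.
have [rho rhoE] : exists rho : herm R n, (rho : 'M[R[i]]_n) = (V *m V ^t*)%R.
  by apply: exists_herm; rewrite trmxC_mul trmxCK.
(* The phase point (V V^H, b V V^H) with V = sqrt t v; the gap between the
   pairing and the support function there is t <v; (a + b^H b / 2) v>. *)
pose x : phase R n N := (rho, (ab.2 : 'M[R[i]]_(n * N, n)) *m (V *m V ^t*))%R.
have x2 : (x.2 : 'M[R[i]]_(n * N, n)) =
  ((ab.2 : 'M[R[i]]_(n * N, n)) *m (V *m V ^t*))%R by [].
apply: ereal_sup_ubound; exists x => //.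
rewrite (support_fun_gram (x := x) rhoE x2) -/(pairing ab x) -EFinB; congr EFin.
have -> : pairing ab x = complex.Re (pairing ab x)%:C by [].
rewrite (pairing_gram ab (x := x) rhoE x2) mulrN -ReZ -{1}(sqr_sqrtr t0).
rewrite -trace_quadZ -/V mulmxN mulNmx !raddfN /= opprK -raddfB.
congr complex.Re; rewrite mulmxDr mulmxDl raddfD /=.
rewrite -[(_ *m (_^-1 *: _))%R]scalemxAr -scalemxAl mxtraceZ.
have -> : (V ^t* *m (ab.2 ^t* *m ab.2) *m V = (ab.2 *m V) ^t* *m (ab.2 *m V))%R.
  by rewrite trmxC_mul !mulmxA.
by rewrite -/(mxdot _ _); field.
Qed.

End Envelope.

Local Open Scope ereal_scope.

Theorem lemma11 (R : realType) (n N : nat) (hn : (1 <= n)%N) (hN : (1 <= N)%N) :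
  [/\ (forall x : phase R n N, 0 <= F x),
      convex_efun (@F R n N),
      lower_semicontinuous (@F R n N),
      is_cvx_lsc_envelope (@F0 R n N) (@F R n N) &
      forall (a : herm R n) (b : cmx R (n * N) n),
        legendre (@F R n N) (a, b) =
        if `[< npsdmx ((a : 'M[R[i]]_n) + 2^-1 *: (b ^t* *m b))%R >] then 0 else +oo].
Proof.
have env := @F_envelope R n N; have [cvx lsc _ _] := env.
split=> // [x|a b]; first by rewrite F_support_fun support_fun_ge0.
have -> : @F R n N = @support_fun R n N by apply/funext/F_support_fun.
exact: legendre_support_fun.
Qed.
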